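(* Let $L>0$ and let $N\ge1$ be an integer. Among all constant stepsizes with $\gamma L\in(0,2)$, the worst-case rate for convex functions $$\frac{f(x_0)-f_*}{1+\gamma L\,\min\Big\{2N,\ \frac{-1+(1-\gamma L)^{-2N}}{\gamma L}\Big\}}$$ is minimized by the choice $\gamma L=\overline{\gamma L}_N(0)$. Consequently, for every $f:\mathbb{R}^d\to\mathbb{R}$ in $\mathcal{F}_{0,L}$ with $f_*:=\inf_xf(x)>-\infty$ and every $x_0\in\mathbb{R}^d$, the iterates $x_{i+1}=x_i-\gamma\nabla f(x_i)$, $i=0,\dots,N-1$, with $\gamma L=\overline{\gamma L}_N(0)$ satisfy $$\frac{1}{2L}\|\nabla f(x_N)\|^2\le\frac{f(x_0)-f_*}{1+2N\,\overline{\gamma L}_N(0)}.$$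
   Context: For $L\in(0,\infty)$, $\mathcal{F}_{0,L}$ is the class of convex functions $f:\mathbb{R}^d\to\mathbb{R}$ such that $\frac{L}{2}\|\cdot\|^2-f$ is convex ($\|\cdot\|$ Euclidean norm; such functions are differentiable). $\overline{\gamma L}_N(0)$ denotes the unique root $\ell\in(1,2)$ of $$T_N(\ell,0)=2N-\frac{-1+(1-\ell)^{-2N}}{\ell}=0 .$$ When $\gamma L=1$, $(1-\gamma L)^{-2N}$ is read as $+\infty$. *)

(* Defs.v *)
From HB Require Import structures.
From mathcomp Require Import all_boot all_order all_algebra.
From mathcomp Require Import all_classical all_reals all_analysis.

Set Implicit Arguments.
Unset Strict Implicit.
Unset Printing Implicit Defensive.

Import Order.TTheory GRing.Theory Num.Theory.
Import numFieldNormedType.Exports.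

Local Open Scope classical_set_scope.
Local Open Scope ring_scope.

(* The library norm on ['rV[R]_d] is the sup norm, hence this definition. *)
Definition enorm (R : realType) (d : nat) (x : 'rV[R]_d) : R :=
  Num.sqrt (\sum_(i < d) x ord0 i ^+ 2).

Definition grad (R : realType) (d : nat) (f : 'rV[R]_d -> R)
    (x : 'rV[R]_d) : 'rV[R]_d :=
  \row_(i < d) 'D_(delta_mx ord0 i) f x.

(* The class F_{0,L}. *)
Definition smooth_convex (R : realType) (d : nat) (L : R)
    (f : 'rV[R]_d -> R) : Prop :=
  convex_function [set: 'rV[R]_d] f /\
  convex_function [set: 'rV[R]_d] (fun x => L / 2 * enorm x ^+ 2 - f x).

(* T_N(l, 0). *)
Definition T0 (R : realType) (N : nat) (l : R) : R :=
  (2 * N)%:R - (- 1 + (1 - l) ^- (2 * N)) / l.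

Definition T0_root (R : realType) (N : nat) (l : R) : Prop :=
  1 < l < 2 /\ T0 N l = 0.

(* The root of T_N(., 0) in (1,2); the default value 0 is not such a root. *)
Definition gammaLbar (R : realType) (N : nat) : R :=
  xget 0 [set l : R | T0_root N l].

(* At l = 1 the power (1 - l)^(-2N) is read as +oo; the field inverse would
   give 0^-1 = 0 instead. *)
Definition decay (R : realType) (N : nat) (l : R) : \bar R :=
  if l == 1 then +oo%E else ((- 1 + (1 - l) ^- (2 * N)) / l)%:E.

(* The minimum is finite, so [fine] loses nothing. *)
Definition worst_case_rate (R : realType) (N : nat) (Delta l : R) : R :=
  Delta / (1 + l * fine (mine ((2 * N)%:R)%:E (decay N l))).

(* Main.v *)
Require Import Defs.
From HB Require Import structures.
From mathcomp Require Import all_boot all_order all_algebra.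
From mathcomp Require Import all_classical all_reals all_analysis.
From mathcomp Require Import ring lra.

Set Implicit Arguments.
Unset Strict Implicit.
Unset Printing Implicit Defensive.

Import Order.TTheory GRing.Theory Num.Theory.
Import numFieldNormedType.Exports.

Local Open Scope classical_set_scope.
Local Open Scope ring_scope.

(** Why the theorem holds.  Put [l = gamma L], [r = l - 1], [g_i] the gradient
    at [x_i], [q_i = |g_i|^2], [F_i = L f(x_i)].  Two functions compete for the
    worst case: one whose gradient stays constant along the trajectory, for
    which [F_0 - F_m = m l q_m], and the quadratic [L/2 |x|^2], for which
    [g_(i+1) = - r g_i] and [F_0 - F_m = (r^(-2m) - 1)/2 q_m].  They give
    the denominators [1 + 2N l], which grows with [l], and [(1 - l)^(-2N)],
    which decreases for [l > 1]; the two cross at the root of [T_N], which is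
    therefore the optimal step size ([worst_case_rate_min]).  The root exists
    and is unique because the equation reads [r^(2N) (1 + 2N(1 + r)) = 1], with
    an increasing left-hand side.

    For the rate itself, the decrease of [f] along the iterates is controlled
    by the interpolation inequality
    [f y - f x >= <g_x, y - x> + |g_y - g_x|^2 / (2L)]
    ([smooth_convex_interpolation]).  For [N >= 2], inequalities between
    consecutive iterates alone do not give the rate; those between [x_i] and
    [x_(i+2)], in both directions, join them.  All are combined in a potential
    that is tight for both competing functions: [F_0 - F_m] is at least
    [(r^(-2m) - 1)/2 q_m + V_m X_m], where [V_m] ([weight]) vanishes at [m = 0]
    and, exactly when [l] is the root, at [m = N]; the convexity of
    [m |-> r^(-2m)] makes it nonnegative in between.  One step of the
    induction ([potential_bound]) is an identity whose remainder is a
    nonnegative combination of the interpolation inequalities, with no square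
    left over.  At [m = N] this gives [F_0 - F_N >= N l q_N]
    ([gradient_descent_rate]), and [f(x_N) - f_* >= q_N / (2L)]
    ([smooth_convex_gap]) supplies the remaining [1] of the denominator.

    Differentiability of [f] is a consequence of the two convexity hypotheses:
    they squeeze the difference quotients along every line
    through [x], which yields directional slopes, their linearity, and the two
    first-order bounds ([smooth_convex_bounds]). *)

(** * A potential for gradient descent *)

(** The multiplier of the inequalities between iterates [m - 1] and [m + 1] in
    the combination behind [potential_bound].  A multiple of the gap between the
    rates of the two competing worst-case functions after [m] steps. *)
Definition weight (R : realFieldType) (r : R) (m : nat) : R :=
  (2 * m%:R * (1 + r) - (r ^- (2 * m) - 1)) / (2 * (1 + r) ^+ 2).

(** Vanishes on the trajectory of the quadratic, where [q m.-1 = q m / r ^+ 2]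
    and [p m.-1 = - q m / r], and equals [(1 + r) ^+ 2 * q m] on a trajectory
    with constant gradient; times [weight r m] it corrects the rate of the
    quadratic exactly into that of the constant gradient.  At [m = 0], where
    [m.-1] is a default, it is multiplied by [weight r 0 = 0]. *)
Definition corrector (R : realFieldType) (r : R) (F q p : nat -> R)
    (m : nat) : R :=
  (1 - r) * (F m.-1 - F m)
  + (1 + r) / 2 * ((2 * r - 1) * q m.-1 + 2 * r * p m.-1 + q m).

Lemma bernoulli_inv (R : realFieldType) (r : R) (k : nat) :
  0 < r -> r < 1 -> k%:R * (1 - r) <= r * (r ^- k - 1).
Proof.
move=> r0 r1; elim: k => [|k IH]; first by rewrite expr0 invr1; lra.
have -> : r * (r ^- k.+1 - 1) = r ^- k - r.
  by rewrite exprS invfM; field; rewrite expf_neq0// gt_eqF.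
rewrite -natr1.
have kr : 0 <= k%:R * (1 - r) by rewrite mulr_ge0 ?ler0n// subr_ge0 ltW.
have : r * (r ^- k - 1) <= r ^- k - 1.
  by rewrite ler_piMl ?(ltW r1)// -(pmulr_rge0 _ r0) (le_trans kr).
lra.
Qed.

Lemma expr_inv_double_S (R : realFieldType) (r : R) (m : nat) :
  r ^- (2 * m.+1) = r ^- (2 * m) / r ^+ 2.
Proof. by rewrite mulnS addnC exprD invfM. Qed.

(** The increments solve [r^2 u_(m+1) = u_m - (1 - r)], the recurrence
    that makes the coefficients of [q m] cancel in [potential_bound]. *)
Lemma weightS (R : realFieldType) (r : R) (m : nat) : 0 < r ->
  weight r m.+1 = weight r m + (1 - (1 - r) * r ^- (2 * m.+1) / 2) / (1 + r).
Proof.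
move=> r0; rewrite /weight expr_inv_double_S -natr1.
have r1 : 1 + r != 0 by rewrite gt_eqF// addr_gt0.
by field; rewrite r1 expf_neq0 ?gt_eqF.
Qed.

(** Here [F i] stands for [L f(x_i)], and [q i], [p i], [t i] for the inner
    products of [g_i] with [g_i], [g_(i+1)], [g_(i+2)].  The four hypotheses are
    the interpolation inequalities for the pairs [(i, i+1)], [(i+1, i)],
    [(i, i+2)], [(i+2, i)].  The last two enter with weights [V_(i+1)] and
    [r V_(i+1)], which eliminates [t i], and the first two with the [a0] and
    [b0] of the proof; these are the values for which the induction
    step becomes an identity. *)
Lemma potential_bound (R : realFieldType) (r : R) (F q p t : nat -> R)
    (N : nat) :
  0 < r -> r < 1 -> (forall m, (m <= N)%N -> 0 <= weight r m) ->
  (forall i, (i < N)%N -> r * p i + (q i + q i.+1) / 2 <= F i - F i.+1) ->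
  (forall i, (i < N)%N ->
     - (r + 1 / 2) * q i + q i.+1 / 2 - p i <= F i.+1 - F i) ->
  (forall i, (i.+1 < N)%N ->
     (q i + q i.+2) / 2 + r * t i + (1 + r) * p i.+1 <= F i - F i.+2) ->
  (forall i, (i.+1 < N)%N ->
     - (r + 1 / 2) * q i + q i.+2 / 2 - t i - (1 + r) * p i <= F i.+2 - F i) ->
  forall m, (m <= N)%N ->
    (r ^- (2 * m) - 1) / 2 * q m + weight r m * corrector r F q p m
    <= F 0%N - F m.
Proof.
move=> r0 r1 w0 hA hB hC hD; elim=> [_|m IH mN].
  rewrite /weight muln0 expr0 invr1 !subrr; lra.
have {IH} := IH (ltnW mN).
have := w0 _ (ltnW mN); have := w0 _ mN.
have := hA _ mN; have := hB _ mN.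
set V := weight r m; set V' := weight r m.+1; set S := r ^- (2 * m).
move=> B A V'0 V0 IH.
have r1' : 1 + r != 0 by rewrite gt_eqF// addr_gt0.
(* The third hypothesis plus [r] times the fourth turns the corrector, which
   looks back to [m - 1], into a quantity that looks ahead to [m + 1]. *)
have two : weight r m * ((1 - r) * (F m.+1 - F m)
       + (1 + r) / 2 * (q m + 2 * p m + q m.+1)) <= V * corrector r F q p m.
  case: m @V @V' @S mN B A V'0 V0 IH => [|m] V V' S mN B A V'0 V0 IH.
    by rewrite /V /weight muln0 expr0 invr1 mulr0 !mul0r !subrr !mul0r.
  apply: ler_wpM2l => //; rewrite /corrector /=.
  have := ler_wpM2l (ltW r0) (hD _ mN); have := hC _ mN.
  lra.
have V'E : V' = V + (1 - (1 - r) * r ^- (2 * m.+1) / 2) / (1 + r).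
  exact: weightS.
have S'E : r ^- (2 * m.+1) = S / r ^+ 2 by exact: expr_inv_double_S.
have S'1 : 0 <= r * (r ^- (2 * m.+1) - 1).
  by apply: le_trans (bernoulli_inv _ r0 r1); rewrite mulr_ge0// subr_ge0 ltW.
(* Multiplier of the inequality for the pair [(m+1, m)]. *)
have b0 : 0 <= r * (r ^- (2 * m.+1) - 1) / (1 + r) + (1 - r) * V.
  by apply: addr_ge0; [apply: divr_ge0 => //; lra | apply: mulr_ge0 => //; lra].
(* Multiplier of the inequality for the pair [(m, m+1)]; [V'] is at most linear
   in [m], and Bernoulli's inequality lets [r ^- (2 * m.+1)] absorb it. *)
have a0 : 0 <= (1 + r * r ^- (2 * m.+1)) / (1 + r) - (1 - r) * V'.
  have := bernoulli_inv (2 * m.+1) r0 r1; rewrite natrM => bern.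
  have -> : (1 + r * r ^- (2 * m.+1)) / (1 + r) - (1 - r) * V' =
    ((2 + 2 * r * r ^- (2 * m.+1)) * (1 + r)
       - (1 - r) * (1 + r) * (2%:R * m.+1%:R)
       + (1 - r) * (r ^- (2 * m.+1) - 1)) / (2 * (1 + r) ^+ 2).
    by rewrite /V' /weight; field; rewrite r1' expf_neq0// gt_eqF.
  apply: divr_ge0; last by rewrite mulr_ge0// exprn_ge0// ltW// addr_gt0.
  have := ler_wpM2l (ltW (ltr_wpDr (ltW r0) (@ltr01 R))) bern.
  have : 0 <= (1 - r) * (r ^- (2 * m.+1) - 1).
    rewrite mulr_ge0 ?subr_ge0 ?(ltW r1)//.
    by move: S'1; rewrite pmulr_rge0// subr_ge0.
  have : 0 <= (1 + r) * (r * (r ^- (2 * m.+1) - 1)).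
    by rewrite mulr_ge0// ltW// addr_gt0.
  nra.
have := mulr_ge0 a0 (_ : 0 <= F m - F m.+1 - (r * p m + (q m + q m.+1) / 2)).
have := mulr_ge0 b0
  (_ : 0 <= F m.+1 - F m - (- (r + 1 / 2) * q m + q m.+1 / 2 - p m)).
rewrite !subr_ge0 => /(_ B) hb /(_ A) ha.
rewrite -subr_ge0.
rewrite -subr_ge0 in IH; rewrite -subr_ge0 in two.
rewrite -subr_ge0 in ha; rewrite -subr_ge0 in hb.
apply: (le_trans (addr_ge0 (addr_ge0 IH two) (addr_ge0 ha hb))).
rewrite le_eqVlt; apply/orP; left; apply/eqP.
rewrite -/V /corrector /= V'E S'E.
by field; rewrite r1' gt_eqF.
Qed.

(** * Sign of the weights up to the root *)

Lemma exprB1_le (R : realFieldType) (s : R) (m : nat) :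
  1 <= s -> s ^+ m - 1 <= m%:R * (s ^+ m * (s - 1)).
Proof.
move=> s1; elim: m => [|m IH]; first by rewrite expr0 subrr mul0r.
rewrite exprS -natr1.
have := ler_wpM2l (le_trans ler01 s1) IH.
have : 1 * (s - 1) <= (s * s ^+ m) * (s - 1).
  by apply: ler_wpM2r; [rewrite subr_ge0|rewrite -exprS exprn_ege1].
nra.
Qed.

(** Convexity of [k |-> s ^+ k]: up to [n] it stays below its chord from [0] to
    [n].  It puts the weights, which vanish at both ends, above zero. *)
Lemma exprB1_slope (R : realFieldType) (s : R) (m n : nat) :
  1 <= s -> (m <= n)%N -> n%:R * (s ^+ m - 1) <= m%:R * (s ^+ n - 1).
Proof.
move=> s1 /subnK <-; elim: (n - m)%N => [//|k IH].
rewrite addSn -natr1 exprS.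
have : s ^+ m - 1 <= m%:R * (s ^+ (k + m) * (s - 1)).
  apply: le_trans (exprB1_le m s1) _; apply: ler_wpM2l; first exact: ler0n.
  by apply: ler_wpM2r; rewrite ?subr_ge0// ler_weXn2l// leq_addl.
nra.
Qed.

Lemma weight_ge0 (R : realFieldType) (r : R) (m N : nat) :
  0 < r -> r < 1 -> (0 < N)%N -> weight r N = 0 -> (m <= N)%N ->
  0 <= weight r m.
Proof.
move=> r0 r1 N0 wN mN.
have dpos : 0 < 2 * (1 + r) ^+ 2 by rewrite mulr_gt0// exprn_gt0// addr_gt0.
have N0' : 0 < N%:R :> R by rewrite ltr0n.
have s1 : 1 <= r ^- 2 by rewrite invf_ge1 ?exprn_gt0// expr_le1// ltW.
have := exprB1_slope s1 mN.
have {wN} : 2 * N%:R * (1 + r) - (r ^- (2 * N) - 1) = 0.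
  move: wN; rewrite /weight => /(congr1 ( *%R^~ (2 * (1 + r) ^+ 2))).
  by rewrite divfK ?mul0r// gt_eqF.
rewrite -!exprVn -!exprM => wN sl.
rewrite /weight; apply: divr_ge0; last exact: ltW.
rewrite -(pmulr_rge0 _ N0') -exprVn; nra.
Qed.

(** * The optimal step size *)

(** Clearing denominators turns the equation into a polynomial one in [l - 1],
    whose left-hand side increases: existence and uniqueness both read off this
    form. *)
Lemma T0_rootE (R : realType) (N : nat) (l : R) :
  T0_root N l <->
  (0 < l - 1 < 1 /\ (l - 1) ^+ (2 * N) * (1 + 2 * N%:R * l) = 1).
Proof.
rewrite /T0_root /T0 natrM.
have bnd : 1 < l < 2 = (0 < l - 1 < 1).
  by apply/idP/idP => /andP[? ?]; apply/andP; split; lra.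
rewrite bnd; split => -[/andP[l0 l1] e]; split; rewrite ?l0//.
all: have ln0 : l != 0 by rewrite gt_eqF//; lra.
all: have q0 : (1 - l) ^+ (2 * N) != 0 by rewrite expf_neq0// lt_eqF//; lra.
all: have eq : (l - 1) ^+ (2 * N) = (1 - l) ^+ (2 * N)
  by rewrite !exprM sqrrB sqrrB; congr (_ ^+ _); ring.
  rewrite eq; move/eqP: e; rewrite subr_eq0 => /eqP e.
  have -> : 1 + 2 * N%:R * l = (1 - l) ^- (2 * N).
    by rewrite e; field; rewrite ?ln0 ?q0.
  by rewrite divff.
have -> : (1 - l) ^- (2 * N) = 1 + 2 * N%:R * l.
  by apply: (mulfI q0); rewrite divff// -eq e.
by field.
Qed.

Lemma T0_root_unique (R : realType) (N : nat) (l l' : R) :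
  (0 < N)%N -> T0_root N l -> T0_root N l' -> l = l'.
Proof.
move=> N0; wlog: l l' / l <= l' => [wl h h'|].
  by case: (leP l l') => [ll|/ltW ll]; [exact: wl|apply/esym; exact: wl].
rewrite le_eqVlt => /orP[/eqP//|ll'].
move=> /T0_rootE[/andP[l0 l1] e] /T0_rootE[/andP[l'0 l'1] e'].
have : (l - 1) ^+ (2 * N) < (l' - 1) ^+ (2 * N).
  by rewrite ltrXn2r ?muln_eq0 ?gtn_eqF//; lra.
move=> lt.
suff : (l - 1) ^+ (2 * N) * (1 + 2 * N%:R * l)
     < (l' - 1) ^+ (2 * N) * (1 + 2 * N%:R * l') by rewrite e e' ltxx.
apply: ltr_pM => //.
- by rewrite exprn_ge0// ltW.
- by rewrite addr_ge0 ?mulr_ge0//; lra.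
- by rewrite ltrD2l ltr_pM2l// mulr_gt0// ltr0n.
Qed.

Lemma T0_root_exists (R : realType) (N : nat) :
  (0 < N)%N -> exists l : R, T0_root N l.
Proof.
move=> N0; pose pol : {poly R} :=
  'X^(2 * N) * (1 + (2 * N%:R) *: (1 + 'X)) - 1.
have polE r : pol.[r] = r ^+ (2 * N) * (1 + 2 * N%:R * (1 + r)) - 1.
  by rewrite /pol !hornerE.
have [|r /andP[r0 r1]] := @poly_ivt R pol 0 1 ler01.
  rewrite !polE expr1n expr0n muln_eq0 /= (gtn_eqF N0) mul0r.
  rewrite sub0r oppr_le0 ler01 /=.
  by rewrite mul1r addrAC subrr add0r !mulr_ge0.
rewrite rootE polE subr_eq0 => /eqP e.
have N1 : 0 < N%:R :> R by rewrite ltr0n.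
exists (1 + r); apply/T0_rootE; rewrite addrAC subrr add0r; split; last by [].
apply/andP; split; rewrite lt_neqAle ?r0 ?r1 andbT.
  apply/eqP => z; move/eqP: e; rewrite -z expr0n muln_eq0 /= (gtn_eqF N0) mul0r.
  by rewrite eq_sym oner_eq0.
by apply/eqP => z; move: e; rewrite z expr1n; lra.
Qed.

Lemma gammaLbarP (R : realType) (N : nat) :
  (0 < N)%N -> T0_root N (gammaLbar R N).
Proof.
by move=> N0; have [l rl] := T0_root_exists R N0; exact: (xgetI 0 rl).
Qed.

(** Bounds on the denominator of the worst-case rate.  At [l = 1] only the
    linear one survives, as [decay] is then infinite. *)
Lemma rate_factor_bounds (R : realType) (N : nat) (l : R) : 0 < l < 2 ->
  let c := 1 + l * fine (mine ((2 * N)%:R)%:E (decay N l)) in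
  [/\ 1 <= c, c <= 1 + 2 * N%:R * l & l != 1 -> c <= (1 - l) ^- (2 * N)].
Proof.
move=> /andP[l0 l2] /=; rewrite /decay; have [->|l1] := eqVneq l 1.
  by rewrite miney /= mul1r mulr1 -natrM lerDl ler0n lexx.
have q0 : 0 < (1 - l) ^+ (2 * N).
  rewrite exprM exprn_gt0// lt_neqAle sqr_ge0 andbT eq_sym sqrf_eq0.
  by rewrite subr_eq0 eq_sym.
have q1 : 1 <= (1 - l) ^- (2 * N).
  rewrite invf_ge1// exprM exprn_ile1 ?sqr_ge0//; nra.
rewrite -EFin_min /=; set d := _ / l.
have dl : l * d = -1 + (1 - l) ^- (2 * N) by rewrite /d mulrC divfK// gt_eqF.
have d0 : 0 <= d by rewrite -(pmulr_rge0 _ l0) dl; lra.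
split.
- by rewrite lerDl mulr_ge0 ?(ltW l0)// le_min ler0n d0.
- by rewrite lerD2l mulrC -natrM ler_wpM2r ?(ltW l0)// ge_min lexx.
- move=> _; have -> : (1 - l) ^- (2 * N) = 1 + l * d by rewrite dl; ring.
  by rewrite lerD2l ler_wpM2l ?(ltW l0)// ge_min lexx orbT.
Qed.

Lemma rate_factor_root (R : realType) (N : nat) (l : R) : T0_root N l ->
  1 + l * fine (mine ((2 * N)%:R)%:E (decay N l)) = 1 + 2 * N%:R * l.
Proof.
move=> [/andP[l1 l2] /eqP]; rewrite /T0 subr_eq0 => /eqP e.
by rewrite /decay gt_eqF// -e minxx /= natrM mulrC.
Qed.

Lemma worst_case_rate_min (R : realType) (N : nat) (Delta l l' : R) :
  0 <= Delta -> T0_root N l -> 0 < l' < 2 ->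
  worst_case_rate N Delta l <= worst_case_rate N Delta l'.
Proof.
move=> D0 rl hl'; rewrite /worst_case_rate rate_factor_root//.
have [c1 c2 c3] := rate_factor_bounds N hl'.
have /T0_rootE[/andP[l0 l1] e] := rl.
have N0 : 0 <= N%:R :> R by rewrite ler0n.
have c0 := lt_le_trans ltr01 c1.
apply: ler_wpM2l => //; rewrite lef_pV2 ?posrE//; last first.
  by rewrite (lt_le_trans ltr01)// lerDl !mulr_ge0//; lra.
(* Left of the root the bound [1 + 2 N l'] is at most the optimal denominator;
   right of it the bound [(1 - l') ^- (2 * N)] is, since it decreases to the
   right of 1. *)
have [ll|ll] := leP l' l.
  by apply: le_trans c2 _; rewrite lerD2l ler_wpM2l// mulr_ge0.
apply: le_trans (c3 _) _; first by rewrite gt_eqF//; lra.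
have eP : 1 + 2 * N%:R * l = (l - 1) ^- (2 * N).
  have q0 : (l - 1) ^+ (2 * N) != 0 by rewrite expf_neq0// gt_eqF.
  by apply: (mulfI q0); rewrite e divff.
have -> : (1 - l') ^- (2 * N) = (l' - 1) ^- (2 * N).
  by rewrite -[1 - l']opprB exprNn exprM sqrrN !expr1n mul1r.
rewrite eP lef_pV2 ?posrE ?exprn_gt0//; try lra.
by apply: lerXn2r; rewrite ?nnegrE; lra.
Qed.

(** * Euclidean inner product *)

Definition dotp (R : realType) (d : nat) (u v : 'rV[R]_d) : R :=
  \sum_(i < d) u ord0 i * v ord0 i.

Section Dotp.
Variables (R : realType) (d : nat).
Implicit Types (u v w : 'rV[R]_d) (c : R).

Lemma dotpC u v : dotp u v = dotp v u.
Proof. by apply: eq_bigr => i _; rewrite mulrC. Qed.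

Lemma dotpDl u v w : dotp (u + v) w = dotp u w + dotp v w.
Proof. by rewrite -big_split; apply: eq_bigr => i _; rewrite mxE mulrDl. Qed.

Lemma dotpZl c u v : dotp (c *: u) v = c * dotp u v.
Proof. by rewrite mulr_sumr; apply: eq_bigr => i _; rewrite mxE mulrA. Qed.

Lemma dotpNl u v : dotp (- u) v = - dotp u v.
Proof. by rewrite -scaleN1r dotpZl mulN1r. Qed.

Lemma dotpDr u v w : dotp w (u + v) = dotp w u + dotp w v.
Proof. by rewrite dotpC dotpDl !(dotpC w). Qed.

Lemma dotpZr c u v : dotp u (c *: v) = c * dotp u v.
Proof. by rewrite dotpC dotpZl dotpC. Qed.

Lemma dotpNr u v : dotp u (- v) = - dotp u v.
Proof. by rewrite dotpC dotpNl dotpC. Qed.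

Lemma enorm_sqr u : enorm u ^+ 2 = dotp u u.
Proof.
rewrite /enorm sqr_sqrtr; first by apply: eq_bigr => i _; rewrite expr2.
by apply: sumr_ge0 => i _; rewrite sqr_ge0.
Qed.

End Dotp.

Definition dotpE := (dotpDl, dotpDr, dotpNl, dotpNr, dotpZl, dotpZr).

(** * First-order bounds for smooth convex functions *)

Lemma convex_functionE (R : realType) (d : nat) (f : 'rV[R]_d -> R)
    (x y : 'rV[R]_d) (t : R) :
  convex_function [set: 'rV[R]_d] f -> 0 <= t <= 1 ->
  f (t *: x + (1 - t) *: y) <= t * f x + (1 - t) * f y.
Proof.
move=> cf /andP[t0 t1].
by have := cf (Itv01 t0 t1) x y; rewrite !inE => /(_ I I).
Qed.

Lemma convex_around (R : realType) (d : nat) (f : 'rV[R]_d -> R)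
    (x v : 'rV[R]_d) (s t : R) :
  convex_function [set: 'rV[R]_d] f -> 0 < s -> 0 < t ->
  (s + t) * f x <= t * f (x - s *: v) + s * f (x + t *: v).
Proof.
move=> cf s0 t0; have st0 : 0 < s + t by rewrite addr_gt0.
have st : s + t != 0 by rewrite gt_eqF.
have k01 : 0 <= t / (s + t) <= 1.
  by rewrite divr_ge0 ?(ltW t0) ?(ltW st0)//= ler_pdivrMr// mul1r lerDr ltW.
have := @convex_functionE R d f (x - s *: v) (x + t *: v) _ cf k01.
have -> : t / (s + t) *: (x - s *: v) + (1 - t / (s + t)) *: (x + t *: v) = x.
  apply/rowP => i; rewrite !mxE; field; exact: st.
rewrite -(ler_pM2l st0) => /le_trans; apply; rewrite le_eqVlt; apply/orP; left.
by apply/eqP; field.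
Qed.

(** The two convexity hypotheses at [x] between [x - s v] and [x + t v]: after
    division by [s t], the forward quotient exceeds the backward one by at most
    [(s + t) L/2 |v|^2]. *)
Lemma smooth_convex_around (R : realType) (d : nat) (L : R) (f : 'rV[R]_d -> R)
    (x v : 'rV[R]_d) (s t : R) :
  smooth_convex L f -> 0 < s -> 0 < t ->
  0 <= t * (f (x - s *: v) - f x) + s * (f (x + t *: v) - f x)
    <= s * t * (s + t) * (L / 2 * dotp v v).
Proof.
move=> [cf cq] s0 t0; have := convex_around x v cf s0 t0.
have := convex_around x v cq s0 t0.
rewrite !enorm_sqr !dotpE (dotpC v x) => hq hf.
by apply/andP; split; lra.
Qed.

(** A directional derivative at [x] with the error bound that smoothness and
    convexity provide.  The bound is uniform in [t], so that additivity in [v]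
    can be obtained without total differentiability. *)
Definition slope (R : realType) (d : nat) (L : R) (f : 'rV[R]_d -> R)
    (x v : 'rV[R]_d) (m : R) : Prop :=
  forall t, 0 <= f (x + t *: v) - f x - t * m <= t ^+ 2 * (L / 2 * dotp v v).

Lemma le0_linear (R : realType) (a k : R) :
  (forall t, 0 < t -> a <= t * k) -> a <= 0.
Proof.
move=> h; rewrite leNgt; apply/negP => a0.
have k1 : 0 < `|k| + 1 by rewrite ltr_wpDl.
have /h : 0 < a / (`|k| + 1) by rewrite divr_gt0.
rewrite mulrAC ler_pdivlMr// ler_pM2l// => /le_trans /(_ (ler_norm k)); lra.
Qed.

Lemma eq0_linear_sqr (R : realType) (a k : R) :
  (forall t, t * a <= t ^+ 2 * k) -> a = 0.
Proof.
move=> h; apply/eqP; rewrite eq_le -oppr_le0; apply/andP.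
split; apply: (@le0_linear _ _ k) => t t0.
  by have := h t; rewrite expr2 -mulrA ler_pM2l.
by have := h (- t); rewrite sqrrN expr2 mulNr -mulrN -mulrA ler_pM2l.
Qed.

(** The slope is the supremum of the backward difference quotients, which is
    below all the forward ones; [smooth_convex_around] bounds the distance. *)
Lemma slope_exists (R : realType) (d : nat) (L : R) (f : 'rV[R]_d -> R)
    (x v : 'rV[R]_d) : smooth_convex L f -> exists m, slope L f x v m.
Proof.
move=> sf; pose q := L / 2 * dotp v v.
pose bwd s := (f x - f (x - s *: v)) / s.
pose fwd t := (f (x + t *: v) - f x) / t.
have around s t : 0 < s -> 0 < t -> 0 <= fwd t - bwd s <= (s + t) * q.
  move=> s0 t0; have := smooth_convex_around x v sf s0 t0.
  have st0 : 0 < s * t by rewrite mulr_gt0.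
  have -> : t * (f (x - s *: v) - f x) + s * (f (x + t *: v) - f x)
       = s * t * (fwd t - bwd s).
    by rewrite /fwd /bwd; field; rewrite !gt_eqF.
  by rewrite -(mulrA (s * t)) pmulr_rge0// ler_pM2l.
pose E := [set bwd s | s in [set s | 0 < s]].
have E1 : E (bwd 1) by exists 1 => //=; exact: ltr01.
have Eub t : 0 < t -> ubound E (fwd t).
  by move=> t0 _ [s s0 <-]; have /andP[] := around _ _ s0 t0; rewrite subr_ge0.
have mfwd t : 0 < t -> sup E <= fwd t.
  by move=> t0; apply: ge_sup; [exists (bwd 1)|exact: Eub].
have bwdm s : 0 < s -> bwd s <= sup E.
  by move=> s0; apply: ub_le_sup; [exists (fwd 1); exact: Eub|exists s].
have fwdm t : 0 < t -> fwd t <= sup E + t * q.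
  move=> t0; rewrite -subr_le0; apply: (@le0_linear _ _ q) => s s0.
  by have /andP[_] := around _ _ s0 t0; have := bwdm _ s0; lra.
have mbwd s : 0 < s -> sup E <= bwd s + s * q.
  move=> s0; rewrite -subr_le0; apply: (@le0_linear _ _ q) => t t0.
  by have /andP[_] := around _ _ s0 t0; have := mfwd _ t0; lra.
exists (sup E) => t; rewrite -/q.
have [t0|t0|->] := ltrgtP t 0; last first.
- by rewrite scale0r addr0 subrr mul0r subr0 expr0n mul0r lexx.
- have -> : f (x + t *: v) - f x - t * sup E = t * (fwd t - sup E).
    by rewrite /fwd; field; rewrite gt_eqF.
  rewrite expr2 -mulrA pmulr_rge0// ler_pM2l// subr_ge0 mfwd//=.
  by rewrite lerBlDl fwdm.
- have s0 : 0 < - t by rewrite oppr_gt0.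
  have -> : f (x + t *: v) - f x - t * sup E = - t * (sup E - bwd (- t)).
    by rewrite /bwd scaleNr opprK; field; rewrite lt_eqF.
  rewrite -sqrrN expr2 -mulrA pmulr_rge0// ler_pM2l// subr_ge0 bwdm//=.
  by rewrite lerBlDl mbwd.
Qed.

Lemma slope_derive (R : realType) (d : nat) (L : R) (f : 'rV[R]_d -> R)
    (x v : 'rV[R]_d) (m : R) : slope L f x v m -> 'D_v f x = m.
Proof.
move=> sm; apply: cvg_lim => //; set q := L / 2 * dotp v v.
apply/cvgrPdist_le => e e0; have k1 : 0 < `|q| + 1 by rewrite ltr_wpDl.
near=> h.
have h0 : h != 0 by near: h; exact: nbhs_dnbhs_neq.
have he : `|h| <= e / (`|q| + 1) by near: h; apply: dnbhs0_le; rewrite divr_gt0.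
have /andP[lo hi] := sm h.
rewrite /= [_ *: _ + x]addrC distrC.
have -> : h^-1 *: (f (x + h *: v) - f x) - m
       = h^-1 * (f (x + h *: v) - f x - h * m).
  by rewrite /GRing.scale /=; field.
rewrite normrM normfV (ger0_norm lo) mulrC ler_pdivrMr ?normr_gt0//.
apply: (le_trans hi).
rewrite -/q -real_normK ?num_real// expr2 -mulrA [e * _]mulrC.
rewrite ler_pM2l ?normr_gt0//.
apply: le_trans (_ : `|h| * (`|q| + 1) <= _); last by rewrite -ler_pdivlMr.
by rewrite ler_wpM2l// (le_trans (ler_norm q))// lerDl.
Unshelve. all: by end_near. Qed.

Lemma slopeZ (R : realType) (d : nat) (L : R) (f : 'rV[R]_d -> R)
    (x v : 'rV[R]_d) (c m : R) :
  slope L f x v m -> slope L f x (c *: v) (c * m).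
Proof.
move=> sm t; rewrite scalerA mulrA dotpZl dotpZr.
have -> : t ^+ 2 * (L / 2 * (c * (c * dotp v v)))
        = (t * c) ^+ 2 * (L / 2 * dotp v v) by ring.
exact: sm.
Qed.

(** The direction [u + v] has some slope [k]; midpoint convexity between
    [x + 2tu] and [x + 2tv] gives [t k <= t (m + n) + O(t^2)], and since [t] may
    have either sign, [k = m + n]. *)
Lemma slopeD (R : realType) (d : nat) (L : R) (f : 'rV[R]_d -> R)
    (x u v : 'rV[R]_d) (m n : R) : smooth_convex L f ->
  slope L f x u m -> slope L f x v n -> slope L f x (u + v) (m + n).
Proof.
move=> sf su sv; have [k sk] := slope_exists x (u + v) sf.
suff <- : k = m + n by [].
apply/eqP; rewrite -subr_eq0; apply/eqP.
apply: (@eq0_linear_sqr _ _ (L * (dotp u u + dotp v v))) => t.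
have /andP[lo _] := sk t.
have /andP[_ hu] := su (2 * t); have /andP[_ hv] := sv (2 * t).
have h01 : 0 <= (2^-1 : R) <= 1 by rewrite invr_ge0 ler0n invf_le1//= ler1n.
have := convex_functionE (x + (2 * t) *: u) (x + (2 * t) *: v) sf.1 h01.
have -> : 2^-1 *: (x + (2 * t) *: u) + (1 - 2^-1) *: (x + (2 * t) *: v)
        = x + t *: (u + v).
  by apply/rowP => i; rewrite !mxE; field.
lra.
Qed.

Lemma slope_grad (R : realType) (d : nat) (L : R) (f : 'rV[R]_d -> R)
    (x v : 'rV[R]_d) : smooth_convex L f -> slope L f x v (dotp (grad f x) v).
Proof.
move=> sf; rewrite {1}[v]row_sum_delta /dotp.
apply: (big_ind2 (fun w m => slope L f x w m)).
- by have [m] := slope_exists x v sf => /(slopeZ 0); rewrite scale0r mul0r.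
- by move=> u m w n; exact: slopeD.
- move=> i _; rewrite mulrC; apply: slopeZ.
  have [m sm] := slope_exists x (delta_mx ord0 i) sf.
  by rewrite mxE (slope_derive sm).
Qed.

Lemma smooth_convex_bounds (R : realType) (d : nat) (L : R) (f : 'rV[R]_d -> R)
    (x y : 'rV[R]_d) : smooth_convex L f ->
  0 <= f y - f x - dotp (grad f x) (y - x) <= L / 2 * dotp (y - x) (y - x).
Proof.
move=> sf; have := slope_grad x (y - x) sf 1.
by rewrite scale1r [x + _]addrC subrK !mul1r expr1n mul1r.
Qed.

(** Compare at [z = y - (g_y - g_x) / L], the minimizer of the upper quadratic
    model of [f] at [y] minus the affine minorant of [f] at [x]. *)
Lemma smooth_convex_interpolation (R : realType) (d : nat) (L : R)
    (f : 'rV[R]_d -> R) (x y : 'rV[R]_d) : 0 < L -> smooth_convex L f ->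
  dotp (grad f x) (y - x)
    + (2 * L)^-1 * dotp (grad f y - grad f x) (grad f y - grad f x)
  <= f y - f x.
Proof.
move=> L0 sf; set gx := grad f x; set gy := grad f y.
pose z := y - L^-1 *: (gy - gx).
have /andP[lo _] := smooth_convex_bounds x z sf.
have /andP[_ hi] := smooth_convex_bounds y z sf.
have zx : z - x = (y - x) - L^-1 *: (gy - gx) by rewrite addrAC.
have zy : z - y = - (L^-1 *: (gy - gx)) by rewrite addrAC subrr add0r.
move: lo hi; rewrite zx zy -/gx -/gy.
set D := dotp (gy - gx) (gy - gx).
have -> : dotp gx (y - x - L^-1 *: (gy - gx))
        = dotp gx (y - x) - L^-1 * dotp gx (gy - gx).
  by rewrite dotpDr dotpNr dotpZr.
have -> : dotp gy (- (L^-1 *: (gy - gx)))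
        = - (L^-1 * (D + dotp gx (gy - gx))).
  by rewrite dotpNr dotpZr -dotpDl subrK.
rewrite dotpNl dotpNr !opprK dotpZl dotpZr -/D.
have -> : L / 2 * (L^-1 * (L^-1 * D)) = (2 * L)^-1 * D.
  by field; rewrite gt_eqF.
have -> : L^-1 * (D + dotp gx (gy - gx))
        = 2 * ((2 * L)^-1 * D) + L^-1 * dotp gx (gy - gx).
  by field; rewrite gt_eqF.
lra.
Qed.

(** A gradient step of length [1 / L] decreases [f] by at least
    [|g|^2 / (2L)]. *)
Lemma smooth_convex_gap (R : realType) (d : nat) (L : R)
    (f : 'rV[R]_d -> R) (x : 'rV[R]_d) : 0 < L -> smooth_convex L f ->
  has_lbound (range f) ->
  (2 * L)^-1 * dotp (grad f x) (grad f x) <= f x - inf (range f).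
Proof.
move=> L0 sf bf; set g := grad f x; set fmin := inf (range f).
have le_fmin : fmin <= f (x - L^-1 *: g).
  by apply: ge_inf => //; exists (x - L^-1 *: g).
move: fmin le_fmin => fmin le_fmin.
have /andP[_] := smooth_convex_bounds x (x - L^-1 *: g) sf.
have -> : x - L^-1 *: g - x = - (L^-1 *: g) by rewrite addrAC subrr add0r.
rewrite -/g !dotpE !opprK.
have -> : L / 2 * (L^-1 * (L^-1 * dotp g g)) = (2 * L)^-1 * dotp g g.
  by field; rewrite gt_eqF.
have -> : L^-1 * dotp g g = 2 * ((2 * L)^-1 * dotp g g).
  by field; rewrite gt_eqF.
lra.
Qed.

(** * Rate of gradient descent at the optimal step size *)

(** At the root the weight vanishes after [N] steps, and the two competing rates
    coincide: [(r ^- (2 * N) - 1) / 2 = N l]. *)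
Lemma gradient_descent_rate (R : realType) (d : nat) (L gamma : R)
    (f : 'rV[R]_d -> R) (N : nat) (x : nat -> 'rV[R]_d) :
  0 < L -> (0 < N)%N -> smooth_convex L f -> T0_root N (gamma * L) ->
  (forall i, (i < N)%N -> x i.+1 = x i - gamma *: grad f (x i)) ->
  N%:R * (gamma * L) * dotp (grad f (x N)) (grad f (x N))
  <= L * (f (x 0%N) - f (x N)).
Proof.
move=> L0 N0 sf rl xS; pose r := gamma * L - 1; pose g i := grad f (x i).
have /T0_rootE[/andP[r0 r1] re] := rl; rewrite -/r in r0 r1 re.
have lE : gamma * L = 1 + r by rewrite /r; ring.
have rN : r ^- (2 * N) = 1 + 2 * N%:R * (1 + r).
  have rn0 : r ^+ (2 * N) != 0 by rewrite expf_neq0// gt_eqF.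
  by rewrite -lE; apply: (mulfI rn0); rewrite divff.
have wN : weight r N = 0.
  by rewrite /weight rN; field; rewrite gt_eqF// addr_gt0.
have w0 m : (m <= N)%N -> 0 <= weight r m by exact: weight_ge0.
have interp i j :
    L * dotp (g j) (x i - x j) + (dotp (g i) (g i) + dotp (g j) (g j)) / 2
      - dotp (g i) (g j) <= L * f (x i) - L * f (x j).
  have := smooth_convex_interpolation (x j) (x i) L0 sf.
  rewrite -/(g i) -/(g j) -(ler_pM2l L0) !mulrDr mulrN => /(le_trans _); apply.
  rewrite !dotpE (dotpC (g j) (g i)) -subr_ge0 le_eqVlt; apply/orP; left.
  by apply/eqP; field; rewrite gt_eqF.
have step1 i : (i < N)%N -> x i - x i.+1 = gamma *: g i.
  by move=> iN; rewrite xS// opprB addrC subrK.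
have step2 i : (i.+1 < N)%N -> x i - x i.+2 = gamma *: (g i + g i.+1).
  by move=> iN; rewrite scalerDr -step1 1?ltnW// -step1// addrA subrK.
have back (i j : nat) : x i - x j = - (x j - x i) by rewrite opprB.
have := @potential_bound R r
  (fun i => L * f (x i)) (fun i => dotp (g i) (g i))
  (fun i => dotp (g i) (g i.+1)) (fun i => dotp (g i) (g i.+2)) N r0 r1 w0.
move=> /(_ _ _ _ _ N (leqnn N)); rewrite wN mul0r addr0 rN mulrBr => H.
rewrite lE; apply: le_trans (H _ _ _ _).
- by rewrite le_eqVlt; apply/orP; left; apply/eqP; field.
- move=> i iN; apply: le_trans (interp _ _).
  rewrite step1// dotpZr mulrA [L * _]mulrC lE.
  by rewrite (dotpC (g i.+1)); lra.
- move=> i iN; apply: le_trans (interp _ _).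
  rewrite back step1// dotpNr dotpZr mulrN mulrA [L * _]mulrC lE.
  by rewrite (dotpC (g i.+1)); lra.
- move=> i iN; apply: le_trans (interp _ _).
  rewrite step2// dotpZr mulrA [L * _]mulrC lE dotpDr.
  rewrite (dotpC (g i.+2) (g i)) (dotpC (g i.+2) (g i.+1)); lra.
- move=> i iN; apply: le_trans (interp _ _).
  rewrite back step2// dotpNr dotpZr mulrN mulrA [L * _]mulrC lE dotpDr.
  rewrite (dotpC (g i.+2) (g i)); lra.
Qed.

Theorem proposition2p13 (R : realType) (L : R) (hL : 0 < L)
    (N : nat) (hN : (1 <= N)%N) :
  (exists! l : R, T0_root N l) /\ T0_root N (gammaLbar R N) /\
  forall (d : nat) (f : 'rV[R]_d -> R),
    smooth_convex L f -> has_lbound (range f) ->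
    forall (x0 : 'rV[R]_d) (gamma : R), gamma * L = gammaLbar R N ->
      (forall gamma' : R, 0 < gamma' * L < 2 ->
         worst_case_rate N (f x0 - inf (range f)) (gamma * L)
         <= worst_case_rate N (f x0 - inf (range f)) (gamma' * L)) /\
      (forall x : nat -> 'rV[R]_d,
         x 0%N = x0 ->
         (forall i : nat, (i < N)%N ->
            x i.+1 = x i - gamma *: grad f (x i)) ->
         1 / (2 * L) * enorm (grad f (x N)) ^+ 2
         <= (f x0 - inf (range f)) / (1 + (2 * N)%:R * gammaLbar R N)).
Proof.
have rootP := gammaLbarP R hN.
split; first by exists (gammaLbar R N); split => // l; exact: T0_root_unique.
split => // d f sf bf x0 gamma gL; rewrite gL.
have gap0 : 0 <= f x0 - inf (range f).
  by rewrite subr_ge0; apply: ge_inf => //; exists x0.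
have fac1 : 0 < 1 + 2 * N%:R * gammaLbar R N.
  have [/andP[l1 _] _] := rootP.
  by rewrite ltr_wpDr// !mulr_ge0// ltW// (lt_trans ltr01).
split=> [gamma' hg|x xx0 xS]; first exact: worst_case_rate_min.
have rl : T0_root N (gamma * L) by rewrite gL.
have := gradient_descent_rate hL hN sf rl xS; rewrite gL xx0.
have := smooth_convex_gap (x N) hL sf bf.
rewrite natrM ler_pdivlMr// mul1r enorm_sqr.
set G := dotp _ _ => gap dec.
have dec' : (2 * L)^-1 * G * (2 * N%:R * gammaLbar R N) <= f x0 - f (x N).
  rewrite -(ler_pM2l hL); apply: le_trans dec.
  by rewrite le_eqVlt; apply/orP; left; apply/eqP; field; rewrite gt_eqF.
rewrite mulrDr mulr1; apply: (le_trans (lerD gap dec')).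
by rewrite addrC addrA subrK.
Qed.
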